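(* Let $M$ be an oriented matroid on the ground set $[n]=\{1,\dots,n\}$, let $\omega\in\mathbb{R}^n$, and let $\mathcal{F}:=\mathcal{F}(\omega)$ be the flag of $\omega$. The following are equivalent: 1. $M_{\mathcal{F}}$ is acyclic. 2. For each signed circuit $C$ of $M$, $\operatorname{in}_\omega(C)$ contains a positive element and a negative element of $C$. 3. $\mathcal{F}$ is a flag of positive flats of $M$, i.e. every member of the flag $\mathcal{F}$ is a positive flat of $M$.
   Context: Flag of $\omega$: $\mathcal{F}(\omega)$ is the unique flag of subsets $\emptyset=F_0\subset F_1\subset\dots\subset F_k\subset F_{k+1}=[n]$ (strict inclusions) such that $\omega$ is constant on each $F_i\setminus F_{i-1}$ and $\omega|_{F_i\setminus F_{i-1}}<\omega|_{F_{i+1}\setminus F_i}$. The members of the flag are $F_0,F_1,\dots,F_{k+1}$. The oriented matroid $M_{\mathcal{F}}=M_\omega$: for a signed circuit $C$ of $M$, $\operatorname{in}_\omega(C)$ denotes the signed set of elements of $C$ of largest $\omega$-weight among the elements of $C$, with the signs they have in $C$. $M_\omega$ is the oriented matroid on $[n]$ whose signed circuits are the inclusion-minimal members (with respect to supports) of $\{\operatorname{in}_\omega(C): C \text{ a signed circuit of } M\}$ (this is indeed an oriented matroid). It depends only on the flag $\mathcal{F}=\mathcal{F}(\omega)$, so it is also written $M_{\mathcal{F}}$. An oriented matroid is acyclic if it has no signed circuit all of whose elements are positive. A covector $v\in\{+,-,0\}^n$ of $M$ is positive if each of its entries is $+$ or $0$. A flat of $M$ is positive if it is the $0$-set of a positive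 covector; additionally, the set $[n]$ is considered to be a positive flat. *)

(* Defs.v *)
From HB Require Import structures.
From mathcomp Require Import all_boot all_order all_algebra reals.
Set Implicit Arguments.
Unset Strict Implicit.
Unset Printing Implicit Defensive.
Import Order.TTheory GRing.Theory Num.Theory.
Local Open Scope ring_scope.

Inductive sign := Pos | Neg | Zero.

Definition sign_code (s : sign) : option bool :=
  match s with Pos => Some true | Neg => Some false | Zero => None end.
Definition sign_decode (o : option bool) : sign :=
  match o with Some true => Pos | Some false => Neg | None => Zero end.
Lemma sign_codeK : cancel sign_code sign_decode. Proof. by case. Qed.
HB.instance Definition _ := Finite.copy sign (can_type sign_codeK).

Definition sopp (s : sign) : sign :=
  match s with Pos => Neg | Neg => Pos | Zero => Zero end.

(* A signed subset of 'I_n, equivalently a vector in {+,-,0}^n. *)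
Notation signed n := {ffun 'I_n -> sign}.

Section Signed.
Variable n : nat.
Implicit Types (X Y Z : signed n) (A : {set signed n}).

Definition supp X : {set 'I_n} := [set e | X e != Zero].
Definition posp X : {set 'I_n} := [set e | X e == Pos].
Definition negp X : {set 'I_n} := [set e | X e == Neg].
Definition zeros X : {set 'I_n} := [set e | X e == Zero].

Definition szero : signed n := [ffun=> Zero].
Definition svopp X : signed n := [ffun e => sopp (X e)].
Definition scomp X Y : signed n := [ffun e => if X e == Zero then Y e else X e].

Definition orthogonal X Y : bool :=
  [disjoint supp X & supp Y] ||
  [exists e in supp X :&: supp Y, X e == Y e] &&
  [exists e in supp X :&: supp Y, X e == sopp (Y e)].

Definition min_supp A : {set signed n} :=
  [set X in A | [forall Y in A, ~~ (supp Y \proper supp X)]].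

End Signed.

Section OrientedMatroid.
Variable n : nat.
Implicit Types (M : {set signed n}) (X Y Z C : signed n) (F : {set 'I_n}).

(* An oriented matroid on 'I_n is represented by its set M of signed circuits. *)
Record oriented_matroid M : Prop := OrientedMatroid {
  circuit_neq0 : szero n \notin M;
  circuit_opp : forall X, X \in M -> svopp X \in M;
  circuit_incomparable : forall X Y, X \in M -> Y \in M ->
    supp X \subset supp Y -> X = Y \/ X = svopp Y;
  circuit_elimination : forall X Y e, X \in M -> Y \in M -> X <> svopp Y ->
    e \in posp X -> e \in negp Y ->
    exists Z, [/\ Z \in M,
                  posp Z \subset (posp X :|: posp Y) :\ e &
                  negp Z \subset (negp X :|: negp Y) :\ e] }.

Definition acyclic M : Prop :=
  ~ exists2 C, C \in M & forall e, e \in supp C -> C e = Pos.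

(* The signed circuits of the dual oriented matroid. *)
Definition cocircuits M : {set signed n} :=
  min_supp [set Y | (Y != szero n) && [forall X in M, orthogonal X Y]].

(* The covectors are the compositions of cocircuits; the empty composition is
   the zero covector. *)
Definition covector M (v : signed n) : Prop :=
  exists2 s : seq (signed n),
    {subset s <= cocircuits M} & v = foldr (@scomp n) (szero n) s.

Definition positive_vector (v : signed n) : Prop :=
  forall e, v e = Pos \/ v e = Zero.

(* Flats of the underlying matroid: sets F such that no circuit meets the
   complement of F in exactly one element. *)
Definition flat M F : Prop :=
  forall C e, C \in M -> e \in supp C -> supp C :\ e \subset F -> e \in F.

Definition positive_flat M F : Prop :=
  flat M F /\
  (F = [set: 'I_n] \/
   exists v, [/\ covector M v, positive_vector v & F = zeros v]).

Section Weight.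
Variables (R : realType) (w : 'rV[R]_n).

Definition initial C : signed n :=
  [ffun e => if [forall f in supp C, w 0 f <= w 0 e] then C e else Zero].

Definition initial_matroid M : {set signed n} :=
  min_supp [set initial C | C in M].

(* The sequence Fs lists the members F_0, ..., F_{k+1} of the flag of w. *)
Definition is_flag_of (Fs : seq {set 'I_n}) : Prop :=
  [/\ ohead Fs = Some set0,
      last set0 Fs = [set: 'I_n],
      forall i, (i.+1 < size Fs)%N -> nth set0 Fs i \proper nth set0 Fs i.+1,
      forall i, (i.+1 < size Fs)%N -> forall x y,
        x \in nth set0 Fs i.+1 :\: nth set0 Fs i ->
        y \in nth set0 Fs i.+1 :\: nth set0 Fs i -> w 0 x = w 0 y &
      forall i, (i.+2 < size Fs)%N -> forall x y,
        x \in nth set0 Fs i.+1 :\: nth set0 Fs i ->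
        y \in nth set0 Fs i.+2 :\: nth set0 Fs i.+1 -> w 0 x < w 0 y].

(* Every w has a flag, so hypotheses of the form [is_flag_of Fs] are
   satisfiable. *)
Lemma flag_exists : exists Fs, is_flag_of Fs.
Proof.
pose s := sort <=%O (undup [seq w 0 i | i : 'I_n]).
pose L (r : R) := [set i | w 0 i <= r].
have s_lt : sorted <%O s by rewrite sort_lt_sorted undup_uniq.
have s_mem i : w 0 i \in s by rewrite mem_sort mem_undup; apply/imageP; exists i.
have s_val r : r \in s -> exists i, r = w 0 i.
  by rewrite mem_sort mem_undup => /imageP[i _ ->]; exists i.
have ltE := sorted_ltn_nth lt_trans (0 : R) s_lt.
pose Fs := set0 :: map L s.
have nthS i : (i < size s)%N -> nth set0 Fs i.+1 = L (nth 0 s i).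
  by move=> lt_i; rewrite /= (nth_map 0).
have diffE i x : (i.+1 < size Fs)%N ->
    (x \in nth set0 Fs i.+1 :\: nth set0 Fs i) = (w 0 x == nth 0 s i).
  rewrite /= size_map ltnS => lt_i; rewrite -[nth _ _ i]/(nth set0 Fs i.+1) nthS //.
  have [j lt_j wx] := nthP 0 (s_mem x).
  rewrite -wx in_setD inE -wx; case: i lt_i => [|i] lt_i.
    rewrite inE /=; case: j lt_j {wx} => [|j] lt_j; first by rewrite lexx eqxx.
    have lt0 := ltE 0%N j.+1 lt_i lt_j isT.
    by rewrite leNgt lt0 gt_eqF.
  have lt_i' := ltnW lt_i; rewrite nthS // inE -wx -ltNge.
  have lt_ii := ltE i i.+1 lt_i' lt_i (ltnSn i).
  have [lt_ji|lt_ij|-> ] := ltngtP j i.+1; last by rewrite lexx eqxx lt_ii.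
    have /le_lt_trans/(_ lt_ii) lt_ : nth 0 s j <= nth 0 s i.
      move: lt_ji; rewrite ltnS leq_eqVlt => /predU1P[-> //|lt_ji].
      by rewrite ltW // ltE.
    rewrite (lt_eqF lt_); apply/negbTE/negP => /andP[lt_ij _].
    move: lt_ji; rewrite ltnS leq_eqVlt => /predU1P[eji|lt_ji].
      by rewrite eji ltxx in lt_ij.
    by have := lt_trans lt_ij (ltE j i lt_j lt_i' lt_ji); rewrite ltxx.
  have lt_ := ltE i.+1 j lt_i lt_j lt_ij.
  by rewrite (gt_eqF lt_) (leNgt (nth 0 s j)) lt_ andbF.
exists Fs; split=> //.
- have [s0|s_gt0] := posnP (size s).
    rewrite /Fs (size0nil s0) /=; apply/setP=> i; have := s_mem i.
    by rewrite (size0nil s0).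
  have sz : (size Fs).-1 = (size s).-1.+1 by rewrite /= size_map prednK.
  apply/setP=> i; rewrite -nth_last sz nthS ?prednK // !inE.
  have [j lt_j <-] := nthP 0 (s_mem i).
  have : (j <= (size s).-1)%N by rewrite -ltnS prednK.
  rewrite leq_eqVlt => /predU1P[->|lt_j']; first exact: lexx.
  by rewrite ltW // ltE // inE prednK.
- move=> i lt_i; apply/properP; split.
    move: lt_i; rewrite /= size_map ltnS => lt_i.
    rewrite -[nth set0 (map L s) i]/(nth set0 Fs i.+1).
    case: i lt_i => [|i] lt_i; first exact: sub0set.
    rewrite !nthS ?(ltnW lt_i) //; apply/subsetP=> x; rewrite !inE => /le_trans; apply.
    by rewrite ltW // ltE // inE ltnW.
  have lt_i' : (i < size s)%N by move: lt_i; rewrite /= size_map ltnS.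
  have [x wx] := s_val _ (mem_nth 0 lt_i').
  have : x \in nth set0 Fs i.+1 :\: nth set0 Fs i by rewrite diffE // wx.
  by rewrite in_setD => /andP[? ?]; exists x.
- by move=> i lt_i x y; rewrite !diffE // => /eqP-> /eqP->.
- move=> i lt_i x y; rewrite !diffE // ?(ltnW lt_i) // => /eqP-> /eqP->.
  by move: lt_i; rewrite /= size_map ltnS => lt_i; rewrite ltE // inE ltnW.
Qed.

End Weight.
End OrientedMatroid.

(* Main.v *)
Require Import Defs.
From HB Require Import structures.
From mathcomp Require Import all_boot all_order all_algebra reals.
Set Implicit Arguments.
Unset Strict Implicit.
Unset Printing Implicit Defensive.
Import Order.TTheory GRing.Theory Num.Theory.
Local Open Scope ring_scope.

(** Write F_x for the set of elements of weight less than that of x.  If x is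
    an element of largest weight of a circuit C, then the initial part of C is
    the restriction of C to the complement of F_x, so everything can be read in
    the contractions of M by the members of the flag.

    Initial parts are mixed (have both signs) => acyclic: a circuit of the
    initial matroid is the initial part of a circuit.  Conversely, suppose that
    the initial part of C has no negative element and let F be the
    corresponding F_x.  In M/F the restriction of C off F contains, with the
    same signs, a circuit Z.  All elements of Z have the same, largest, weight,
    so Z is again an initial part; it has minimal support because circuits of
    M/F have incomparable supports; and it is positive.  This needs
    contractions, built in [contraction_exists]: M/F is an oriented matroid,
    and every element of C off F lies in a circuit of M/F conformal to C.

    Positive flats => initial parts are mixed: if F_x is the zero set of a
    positive covector v, then v and C are orthogonal and meet exactly in the
    initial part of C, which therefore contains elements of both signs.

    Initial parts are mixed => positive flats: the hypothesis says that, for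
    each member F of the flag, no circuit is positive and nonempty off F, that
    is, M/F is acyclic without loops.  For e outside F we look for a positive
    cocircuit that vanishes on F and not at e; the composition of these
    cocircuits is a positive covector with zero set F.  Enlarge F to a maximal
    G that avoids e and keeps M/G acyclic; geometrically, G is a facet avoiding
    e of the cone of M.  The point is that M/G has rank one, all its elements
    being positively parallel to e ([pair_circuit_of_no_face]); then + off G
    and 0 on G is a cocircuit.  If rank one fails, a Krein-Milman argument
    finds an extreme ray of M/G other than that of e.  Contracting the parallel
    class of this ray keeps the matroid acyclic, which contradicts the
    maximality of G. *)

(** * Signed sets *)

Lemma soppK : involutive sopp. Proof. by case. Qed.

Lemma sopp_eq0 a : (sopp a == Zero) = (a == Zero). Proof. by case: a. Qed.

Section SignedSets.
Variable n : nat.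
Implicit Types (X Y Z : signed n) (F : {set 'I_n}).

Definition del F X : signed n := [ffun e => if e \in F then Zero else X e].

Definition conformal Z X := forall e, Z e = Zero \/ Z e = X e.

Lemma svoppE X e : svopp X e = sopp (X e). Proof. by rewrite ffunE. Qed.

Lemma svoppK : involutive (@svopp n).
Proof. by move=> X; apply/ffunP => e; rewrite !ffunE soppK. Qed.

Lemma supp_svopp X : supp (svopp X) = supp X.
Proof. by apply/setP => e; rewrite !inE svoppE sopp_eq0. Qed.

Lemma del_svopp F X : del F (svopp X) = svopp (del F X).
Proof. by apply/ffunP => e; rewrite !ffunE; case: ifP. Qed.

Lemma del_in F X e : e \in F -> del F X e = Zero.
Proof. by rewrite ffunE => ->. Qed.

Lemma del_notin F X e : e \notin F -> del F X e = X e.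
Proof. by rewrite ffunE => /negbTE->. Qed.

Lemma del_comp F G X : del F (del G X) = del (F :|: G) X.
Proof. by apply/ffunP => e; rewrite !ffunE inE; do 2 case: (e \in _). Qed.

Lemma supp_del F X : supp (del F X) = supp X :\: F.
Proof. by apply/setP => e; rewrite !inE ffunE; case: (e \in F). Qed.

Lemma signed_neq0 X : X != szero n -> exists e, X e != Zero.
Proof.
move=> X0; apply/existsP; apply: contraNT X0; rewrite negb_exists.
by move=> /forallP X0; apply/eqP/ffunP => e; rewrite ffunE; apply/eqP/negPn.
Qed.

Lemma neq0_signed X e : X e != Zero -> X != szero n.
Proof. by apply: contraNneq => ->; rewrite ffunE. Qed.

Lemma conformal_supp Z X : conformal Z X -> supp Z \subset supp X.
Proof.
by move=> ZX; apply/subsetP => e; rewrite !inE; case: (ZX e) => ->.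
Qed.

Lemma conformal_trans Y X Z : conformal X Y -> conformal Y Z -> conformal X Z.
Proof.
move=> XY YZ e; case: (XY e) => ->; first by left.
exact: YZ.
Qed.

Lemma conformal_del F X Y : conformal X Y -> conformal (del F X) (del F Y).
Proof. by move=> XY e; rewrite !ffunE; case: ifP => _; [left | apply: XY]. Qed.

End SignedSets.

(** * Elimination and contraction *)

Section Circuits.
Variables (n : nat) (M : {set signed n}).
Hypothesis hM : oriented_matroid M.
Implicit Types (X Y Z : signed n) (F : {set 'I_n}) (e f g s : 'I_n).

Lemma circuit_nonempty X : X \in M -> exists e, X e != Zero.
Proof.
move=> XM; apply: signed_neq0; apply/eqP => E.
by have := circuit_neq0 hM; rewrite -E XM.
Qed.

Lemma circuit_supp_eq X Y :
  X \in M -> Y \in M -> supp X \subset supp Y -> supp X = supp Y.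
Proof.
move=> XM YM XY; case: (circuit_incomparable hM XM YM XY) => -> //.
exact: supp_svopp.
Qed.

(** Elimination in the pointwise form that is convenient when the sign of the
    eliminated element is not known. *)
Lemma eliminate X Y e : X \in M -> Y \in M -> X <> svopp Y ->
  X e != Zero -> Y e = sopp (X e) ->
  exists2 Z, Z \in M &
    Z e = Zero /\ forall f, [\/ Z f = Zero, Z f = X f | Z f = Y f].
Proof.
wlog Xe : X Y / X e = Pos => [IH|] XM YM XY Xe0 Ye.
  case EX: (X e) Xe0 Ye => // _ Ye; first by apply: IH; rewrite ?EX.
  have [||||||Z ZM [Ze ZE]] := IH Y X; rewrite ?EX ?Ye //.
    by move=> E; apply: XY; rewrite E svoppK.
  exists Z => //; split=> // f.
  by case: (ZE f) => E; [constructor 1 | constructor 3 | constructor 2].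
rewrite Xe in Ye.
have [||Z [ZM /subsetP Zp /subsetP Zn]] :=
  circuit_elimination (e := e) hM XM YM XY; rewrite ?inE ?Xe ?Ye //.
exists Z => //; split=> [|f].
  case E: (Z e) => //; first by have := Zp e; rewrite !inE E !eqxx /= => /(_ isT).
  by have := Zn e; rewrite !inE E !eqxx /= => /(_ isT).
case E: (Z f); last by constructor 1.
- have := Zp f; rewrite !inE E => /(_ isT) /andP[_ /orP[/eqP->|/eqP->]].
    by constructor 2.
  by constructor 3.
- have := Zn f; rewrite !inE E => /(_ isT) /andP[_ /orP[/eqP->|/eqP->]].
    by constructor 2.
  by constructor 3.
Qed.

End Circuits.

(** K plays the role of M/F, kept on the same ground set with 0 on F.  The last
    field is a conformal decomposition of the vectors of M/F that come from
    circuits of M.  That the circuit can be chosen through a given element g is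
    what makes the property stable under successive contractions: a circuit
    conformal to X might otherwise lie inside the set contracted next. *)
Record is_contraction n (M : {set signed n}) (F : {set 'I_n})
    (K : {set signed n}) : Prop := IsContraction {
  contraction_om : oriented_matroid K;
  contraction_lift : forall Z, Z \in K -> exists2 X, X \in M & Z = del F X;
  contraction_cover : forall X g, X \in M -> g \notin F -> X g != Zero ->
    exists2 Z, Z \in K & Z g != Zero /\ conformal Z (del F X) }.

Section ContractOne.
Variables (n : nat) (M : {set signed n}).
Variable s : 'I_n.
Implicit Types (X Y Z : signed n) (e f g : 'I_n).

Local Notation d := (del [set s]).

Definition contract1 : {set signed n} :=
  min_supp [set d X | X in M & d X != szero n].

Lemma contract1P Z : reflect
  ((exists2 X, X \in M & Z = d X) /\ Z != szero n /\
    (forall Y, Y \in M -> d Y != szero n -> supp (d Y) \subset supp Z ->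
       supp (d Y) = supp Z))
  (Z \in contract1).
Proof.
apply: (iffP idP).
  rewrite inE => /andP[/imsetP[X]]; rewrite inE => /andP[XM X0 ->] /forallP mZ.
  split; [by exists X | split=> // Y YM Y0 YX].
  have := mZ (d Y); rewrite imset_f ?inE ?YM //= properE YX negbK /= => XY.
  by apply/eqP; rewrite eqEsubset YX.
move=> [[X XM EX] [Z0 mZ]]; rewrite inE; apply/andP; split.
  by rewrite EX imset_f // inE XM -EX.
apply/forallP => U; apply/implyP => /imsetP[Y]; rewrite inE => /andP[YM Y0 ->].
by apply/negP => pYZ; move: (pYZ); rewrite (mZ Y) ?properxx // proper_sub.
Qed.

Lemma del1_at X : d X s = Zero. Proof. by rewrite del_in // inE. Qed.

Lemma del1_off X e : e != s -> d X e = X e.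
Proof. by move=> es; rewrite del_notin // inE. Qed.

Hypothesis hM : oriented_matroid M.

(** A circuit through s stays minimal when s is contracted: a competitor with or
    without s would have its support inside that of X already in M. *)
Lemma del_circuit_in_contract1 X :
  X \in M -> X s != Zero -> d X != szero n -> d X \in contract1.
Proof.
move=> XM Xs X0; apply/contract1P; split; [by exists X | split=> // Y YM _ YX].
rewrite !supp_del; congr (_ :\: _); apply: (circuit_supp_eq hM) => //.
apply/subsetP => e; have [->|es] := eqVneq e s; first by rewrite !inE Xs.
by move: YX; rewrite !supp_del => /subsetP/(_ e); rewrite !inE es.
Qed.

(** The result of an elimination does not vanish off s: otherwise s is a loop,
    so X and Y, not being supported on s, avoid s, and then so does Z. *)
Lemma del_elim_neq0 X Y Z : X \in M -> Y \in M -> Z \in M ->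
  d X != szero n -> d Y != szero n ->
  (forall f, [\/ Z f = Zero, Z f = X f | Z f = Y f]) -> d Z != szero n.
Proof.
move=> XM YM ZM X0 Y0 ZE; apply/eqP => Z0.
have Zf f : f != s -> Z f = Zero by move=> fs; rewrite -del1_off // Z0 ffunE.
have [e Ze] := circuit_nonempty hM ZM.
have es : e = s by apply/eqP; apply: contraNT Ze => /Zf->.
subst e.
have absurd U : U \in M -> d U != szero n -> U s != Zero -> False.
  move=> UM U0 Us; case/negP: U0; apply/eqP/ffunP => f; rewrite [RHS]ffunE.
  have [->|fs] := eqVneq f s; first by rewrite del1_at.
  have /setP/(_ f) : supp Z = supp U.
    apply: (circuit_supp_eq hM) => //; apply/subsetP => h; rewrite !inE.
    by have [->|/Zf->] := eqVneq h s.
  by rewrite !inE Zf // del1_off // eqxx; case: (U f).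
case: (ZE s) => E; rewrite E in Ze; first by rewrite eqxx in Ze.
- exact: (absurd X).
- exact: (absurd Y).
Qed.

(** Let X be a circuit avoiding s.  If some circuit lies in X and s and goes
    through s, then one of them is conformal to X off s, with any sign a at s:
    take one with the fewest disagreements with X and eliminate a disagreement
    against X.  The result still goes through s, with sign a, since otherwise
    its support would be strictly contained in that of X. *)
Lemma conformal_through X Y0 a : X \in M -> X s = Zero -> Y0 \in M ->
  Y0 s != Zero -> supp (d Y0) \subset supp X -> a != Zero ->
  exists2 Y, Y \in M & Y s = a /\ conformal (d Y) X.
Proof.
move=> XM Xs Y0M Y0s Y0X a0.
pose P Y := [&& Y \in M, Y s == a & supp (d Y) \subset supp X].
have [Y1 PY1] : exists Y1, P Y1.
  have [E|E] := eqVneq (Y0 s) a; first by exists Y0; rewrite /P Y0M E eqxx.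
  exists (svopp Y0); rewrite /P (circuit_opp hM) // svoppE del_svopp.
  rewrite supp_svopp Y0X andbT /=.
  by move: a0 E Y0s; case: (a); case: (Y0 s).
pose sep Y := [set f | (d Y f != Zero) && (d Y f != X f)].
case: (arg_minnP (fun Y => #|sep Y|) PY1) => Y /and3P[YM /eqP Ys YX] mY.
exists Y => //; split=> // e.
have [->|Ye0] := eqVneq (d Y e) Zero; first by left.
have [->|YXe] := eqVneq (d Y e) (X e); first by right.
have es : e != s by apply: contraNneq Ye0 => ->; rewrite del1_at.
have Xe0 : X e != Zero by have := subsetP YX e; rewrite !inE => /(_ Ye0).
have EY : Y e = sopp (X e).
  by move: Ye0 YXe Xe0; rewrite del1_off //; case: (Y e); case: (X e).
have [|Z ZM [Ze ZE]] := eliminate hM XM YM _ Xe0 EY.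
  move=> E; move: a0; rewrite -Ys -sopp_eq0 -svoppE -E Xs //.
have ZX f : f != s -> Z f != Zero -> X f != Zero.
  move=> fs; case: (ZE f) => -> //.
  by have := subsetP YX f; rewrite !inE del1_off.
have Zs : Z s = a.
  (* Z cannot avoid s: its support would then miss e inside X. *)
  have [Zs0|] := eqVneq (Z s) Zero; last by case: (ZE s) => ->; rewrite ?Xs ?eqxx.
  have /setP/(_ e) : supp Z = supp X.
    apply: (circuit_supp_eq hM) => //; apply/subsetP => f; rewrite !inE.
    by have [->|/ZX] := eqVneq f s; rewrite ?Zs0.
  by rewrite !inE Ze Xe0.
have PZ : P Z.
  rewrite /P ZM Zs eqxx /=; apply/subsetP => f; rewrite !inE.
  by have [->|fs] := eqVneq f s; rewrite ?del1_at // del1_off //; apply: ZX.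
have := mY Z PZ; rewrite leqNgt => /negP[]; apply: proper_card.
apply/properP; split; last first.
  by exists e; rewrite !inE ?Ye0 ?YXe // del1_off // Ze.
apply/subsetP => f; rewrite !inE.
have [->|fs] := eqVneq f s; first by rewrite del1_at.
by rewrite !del1_off //; case: (ZE f) => ->; rewrite ?eqxx ?andbF.
Qed.

(** The only delicate case is that of a circuit X that avoids s and is no longer
    minimal after contraction.  Then there are circuits Y1 and Y2 conformal to
    X off s with opposite signs at s.  Together they cover X: eliminating s
    between them gives a circuit inside X, hence all of X. *)
Lemma contract1_cover X g : X \in M -> g != s -> X g != Zero ->
  exists2 Z, Z \in contract1 & Z g != Zero /\ conformal Z (d X).
Proof.
move=> XM gs Xg.
have dX0 : d X != szero n by apply: (@neq0_signed _ _ g); rewrite del1_off.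
have [Xs|Xs] := eqVneq (X s) Zero; last first.
  exists (d X); first exact: del_circuit_in_contract1.
  by rewrite del1_off //; split=> // e; right.
have dXE : d X = X.
  by apply/ffunP => e; have [->|/del1_off->] := eqVneq e s; rewrite ?del1_at ?Xs.
have [XK|XK] := boolP (d X \in contract1).
  by exists (d X) => //; rewrite del1_off //; split=> // e; right.
have [Y0 Y0M [Y00 Y0X nY0X]] : exists2 Y, Y \in M &
    [/\ d Y != szero n, supp (d Y) \subset supp X & supp (d Y) != supp X].
  have : [exists Y in M, [&& d Y != szero n, supp (d Y) \subset supp X
                        & supp (d Y) != supp X]].
    apply: contraNT XK => /existsPn noY; apply/contract1P.
    split; [by exists X | split=> // Y YM Y0 YX].
    apply/eqP; move: (noY Y); rewrite dXE in YX *; rewrite YM Y0 YX /=.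
    by rewrite negbK.
  by move=> /existsP[Y /and4P[? ? ? ?]]; exists Y.
have Y0s : Y0 s != Zero.
  apply: contra nY0X => /eqP Y0s; apply/eqP.
  have E : d Y0 = Y0.
    by apply/ffunP => e; have [->|/del1_off->] := eqVneq e s; rewrite ?del1_at ?Y0s.
  by rewrite E in Y0X *; apply: (circuit_supp_eq hM).
have [//|Y1 Y1M [Y1s Y1X]] :=
  conformal_through XM Xs Y0M Y0s Y0X (a := Pos) _.
have [//|Y2 Y2M [Y2s Y2X]] :=
  conformal_through XM Xs Y0M Y0s Y0X (a := Neg) _.
suff [Y [YM Ys YX Yg]] : exists Y,
    [/\ Y \in M, Y s != Zero, conformal (d Y) X & Y g != Zero].
  exists (d Y); last by rewrite dXE del1_off.
  apply: del_circuit_in_contract1 => //.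
  by apply: (@neq0_signed _ _ g); rewrite del1_off.
have [Y1g|Y1g] := eqVneq (Y1 g) Zero; last by exists Y1; rewrite Y1s.
have [Y2g|Y2g] := eqVneq (Y2 g) Zero; last by exists Y2; rewrite Y2s.
have [|||Z ZM [Zs ZE]] := eliminate (e := s) hM Y1M Y2M; rewrite ?Y1s ?Y2s //.
  move=> E.
  have Y1f f : f != s -> Y1 f = Zero.
    move=> fs; have := Y1X f; have := Y2X f; rewrite !del1_off // E svoppE.
    by case: (Y2 f) => //; case: (X f) => // -[] // _ [].
  have /setP S : supp Y1 = supp Y0.
    apply: (circuit_supp_eq hM) => //; apply/subsetP => f; rewrite !inE.
    by have [->|/Y1f->] := eqVneq f s.
  have [f] := signed_neq0 Y00; have [->|fs] := eqVneq f s; first by rewrite del1_at.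
  by rewrite del1_off //; have := S f; rewrite !inE Y1f // => <-.
have /setP/(_ g) : supp Z = supp X.
  apply: (circuit_supp_eq hM) => //; apply: conformal_supp => f.
  have [->|fs] := eqVneq f s; first by left.
  have := Y1X f; have := Y2X f; rewrite !del1_off //.
  by case: (ZE f) => ->; [left | |].
by rewrite !inE Xg; case: (ZE g) => ->; rewrite ?Y1g ?Y2g.
Qed.

Lemma contract1_om : oriented_matroid contract1.
Proof.
split.
- by apply/contract1P => -[_ [/eqP]].
- move=> Z /contract1P[[X XM ->] [X0 mX]]; apply/contract1P; split.
    by exists (svopp X); rewrite ?(circuit_opp hM) // del_svopp.
  rewrite supp_svopp; split=> //.
  have [e Xe] := signed_neq0 X0; apply: (@neq0_signed _ _ e).
  by rewrite svoppE sopp_eq0.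
- move=> _ _ /contract1P[[X XM ->] [X0 mX]] /contract1P[[Y YM ->] [Y0 mY]] XY.
  have [->|nXY] := eqVneq (d X) (d Y); first by left.
  have [->|nXoY] := eqVneq (d X) (svopp (d Y)); first by right.
  have /setP eXY := mY _ XM X0 XY.
  have [e Xe] : exists e, d X e != d Y e.
    apply/existsP; apply: contraNT nXY; rewrite negb_exists => /forallP E.
    by apply/eqP/ffunP => e; apply/eqP/negPn/E.
  have es : e != s by apply: contraNneq Xe => ->; rewrite !del1_at.
  have := eXY e; rewrite !inE !del1_off // in Xe *.
  move=> eXYe; have Xe0 : X e != Zero by move: Xe eXYe; case: (X e); case: (Y e).
  have [||Z ZM [Ze ZE]] := eliminate (e := e) hM XM YM _ Xe0.
  + by move=> E; case/eqP: nXoY; rewrite E del_svopp.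
  + by move: Xe eXYe Xe0; case: (X e); case: (Y e).
  have /setP/(_ e) : supp (d Z) = supp (d X).
    apply: mX => //; first exact: del_elim_neq0 ZE.
    apply/subsetP => f; have [->|fs] := eqVneq f s; first by rewrite !inE !del1_at.
    have := eXY f; rewrite !inE !del1_off // => E.
    by case: (ZE f) => ->; rewrite ?E.
  by rewrite !inE !del1_off // Ze Xe0.
- move=> _ _ e /contract1P[[X XM ->] [X0 _]] /contract1P[[Y YM ->] [Y0 _]] XY.
  rewrite !inE => Xe Ye.
  have es : e != s by apply: contraTneq Xe => ->; rewrite del1_at.
  rewrite !del1_off // in Xe Ye.
  have [|||Z ZM [Ze ZE]] := eliminate (e := e) hM XM YM.
  + by move=> E; apply: XY; rewrite E del_svopp.
  + by rewrite (eqP Xe).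
  + by rewrite (eqP Xe) (eqP Ye).
  have [g dZg] := signed_neq0 (del_elim_neq0 XM YM ZM X0 Y0 ZE).
  have gs : g != s by apply: contraNneq dZg => ->; rewrite del1_at.
  rewrite del1_off // in dZg.
  have [W WK [_ WZ]] := contract1_cover ZM gs dZg.
  exists W; split=> //; apply/subsetP => f; rewrite !inE => /eqP Wf.
  all: have := WZ f; rewrite Wf => -[] // /esym Zf.
  all: have fs : f != s by apply/eqP => E; rewrite E del1_at in Zf.
  all: rewrite del1_off // in Zf; rewrite !del1_off //.
  all: have -> /= : f != e by apply: contra_eqN Zf => /eqP->; rewrite Ze.
  all: by case: (ZE f); rewrite Zf => // <-; rewrite eqxx ?orbT.
Qed.

Lemma contract1_contraction : is_contraction M [set s] contract1.
Proof.
split; first exact: contract1_om.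
  by move=> Z /contract1P[].
by move=> X g XM; rewrite inE; apply: contract1_cover.
Qed.

End ContractOne.

Lemma contraction_trans n (M K L : {set signed n}) F G :
  is_contraction M F K -> is_contraction K G L -> is_contraction M (G :|: F) L.
Proof.
move=> MK KL; split; first exact: (contraction_om KL).
  move=> Z /(contraction_lift KL)[Y /(contraction_lift MK)[X XM ->] ->].
  by exists X; rewrite // del_comp.
move=> X g XM; rewrite inE negb_or => /andP[gG gF] Xg.
have [Y YK [Yg YX]] := contraction_cover MK XM gF Xg.
have [Z ZL [Zg ZY]] := contraction_cover KL YK gG Yg.
exists Z => //; split=> //; apply: conformal_trans ZY _.
by rewrite -del_comp; apply: conformal_del.
Qed.

Lemma contraction_exists n (M : {set signed n}) (F : {set 'I_n}) :
  oriented_matroid M -> exists K, is_contraction M F K.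
Proof.
move=> hM; rewrite -[F]set_enum; elim: (enum F) => [|s r [K MK]].
  exists M; split=> //.
    by move=> Z ZM; exists Z => //; apply/ffunP => e; rewrite del_notin ?inE.
  move=> X g XM _ Xg; exists X => //; split=> // e; right.
  by rewrite del_notin ?inE.
exists (contract1 K s); rewrite set_cons.
apply: (contraction_trans MK).
exact: contract1_contraction s (contraction_om MK).
Qed.

(** * Rank one from the absence of proper faces *)

Section Pairs.
Variable n : nat.
Implicit Types a b x : 'I_n.

(** Membership of this signed set in an acyclic oriented matroid says that a and b
    are positively parallel. *)
Definition pair_circuit a b : signed n :=
  [ffun x => if x == a then Pos else if x == b then Neg else Zero].

Lemma pair_circuitP (X : signed n) a b :
  posp X = [set a] -> negp X = [set b] -> X = pair_circuit a b.
Proof.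
move=> /setP Xp /setP Xn; apply/ffunP => x; rewrite ffunE.
by have := Xp x; have := Xn x; rewrite !inE => <- <-; case: (X x).
Qed.

Lemma svopp_pair a b : a != b -> svopp (pair_circuit a b) = pair_circuit b a.
Proof.
move=> ab; apply/ffunP => x; rewrite !ffunE.
by have [->|_] := eqVneq x a; [rewrite (negbTE ab) | case: (x == b)].
Qed.

Lemma negp_pair a b : a != b -> negp (pair_circuit a b) = [set b].
Proof.
move=> ab; apply/setP => x; rewrite !inE ffunE.
by have [->|_] := eqVneq x a; [rewrite (negbTE ab) | case: (x == b)].
Qed.

Lemma posp_pair a b : posp (pair_circuit a b) = [set a].
Proof. by apply/setP => x; rewrite !inE ffunE; case: (x == a); case: (x == b). Qed.

Lemma supp_pair a b : supp (pair_circuit a b) = [set a; b].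
Proof. by apply/setP => x; rewrite !inE ffunE; case: (x == a); case: (x == b). Qed.

End Pairs.

Lemma posp_svopp n (X : signed n) : posp (svopp X) = negp X.
Proof. by apply/setP => x; rewrite !inE svoppE; case: (X x). Qed.

Lemma negp_svopp n (X : signed n) : negp (svopp X) = posp X.
Proof. by apply/setP => x; rewrite !inE svoppE; case: (X x). Qed.

(** In this section K is an acyclic oriented matroid on the ground set D.  A
    circuit whose only negative element is f says that f lies in the cone
    spanned by the positive elements.  The hypothesis [no_face] says that no
    nonempty set avoiding e can be contracted keeping K acyclic. *)
Section Acyclic.
Variables (n : nat) (K : {set signed n}) (D : {set 'I_n}) (e : 'I_n).
Hypothesis hK : oriented_matroid K.
Hypothesis K_acyclic : forall X, X \in K -> negp X != set0.
Hypothesis K_supp : forall X, X \in K -> supp X \subset D.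
Hypothesis eD : e \in D.
Hypothesis no_face : forall A : {set 'I_n}, A :&: D != set0 -> e \notin A ->
  exists2 Z, Z \in K & negp Z \subset A /\ ~~ (posp Z \subset A).
Implicit Types (X Y Z : signed n) (T : {set 'I_n}) (a f h s : 'I_n).

Lemma acyclic_pos X : X \in K -> posp X != set0.
Proof. by move=> XK; rewrite -negp_svopp K_acyclic // (circuit_opp hK). Qed.

(** If f lies in the cone of a set containing s, and s in the cone of another
    set, then f lies in the cone obtained by replacing s.  Acyclicity makes up
    for the weakness of the elimination axiom: the result has a negative
    element, and it can only be f. *)
Lemma acyclic_substitution X Y f s : X \in K -> Y \in K -> X <> svopp Y ->
  negp X \subset [set f] -> s \in posp X -> negp Y \subset [set s; f] ->
  s \in negp Y ->
  exists2 Z, Z \in K &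
    negp Z = [set f] /\ posp Z \subset (posp X :|: posp Y) :\ s.
Proof.
move=> XK YK XY Xf sX Ys sY.
have [Z [ZK Zp Zn]] := circuit_elimination hK XK YK XY sX sY.
exists Z => //; split=> //; apply/eqP; rewrite eqEsubset; apply/andP.
have Zf : negp Z \subset [set f].
  apply: (subset_trans Zn); apply/subsetP => x; rewrite in_setD1 in_setU.
  case/andP=> xs /orP[/(subsetP Xf)//|/(subsetP Ys)].
  by rewrite !inE (negbTE xs).
split=> //; have /set0Pn[x xZ] := K_acyclic ZK.
by have := subsetP Zf _ xZ; rewrite inE => /eqP <-; rewrite sub1set.
Qed.

Lemma pair_trans a b c : a != b -> b != c -> a != c ->
  pair_circuit a b \in K -> pair_circuit b c \in K -> pair_circuit a c \in K.
Proof.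
move=> ab bc ac abK bcK.
have [|||||Z ZK [Zn Zp]] := acyclic_substitution (f := c) (s := b) bcK abK.
- rewrite svopp_pair // => /ffunP/(_ a); rewrite !ffunE eqxx.
  by rewrite (negbTE ab) (negbTE ac).
- by rewrite negp_pair.
- by rewrite posp_pair inE.
- by rewrite negp_pair // sub1set !inE eqxx.
- by rewrite negp_pair // inE.
suff <- : Z = pair_circuit a c by [].
apply: pair_circuitP => //; apply/eqP; rewrite eqEsubset; apply/andP.
have Za : posp Z \subset [set a].
  apply: (subset_trans Zp); rewrite !posp_pair; apply/subsetP => x.
  by rewrite !inE; case: eqP.
split=> //; have /set0Pn[x xZ] := acyclic_pos ZK.
by have := subsetP Za _ xZ; rewrite inE => /eqP <-; rewrite sub1set.
Qed.

(** T generates the cone of K, and contains e. *)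
Definition generates T := (e \in T) && [forall f in D :\: T,
  [exists X in K, (negp X == [set f]) && (posp X \subset T)]].

Lemma generatesP T f : generates T -> f \in D -> f \notin T ->
  exists2 X, X \in K & negp X = [set f] /\ posp X \subset T.
Proof.
move=> /andP[_ /forall_inP gT] fD fT.
have /existsP[X /and3P[XK /eqP Xf XT]] := gT f (introT setDP (conj fD fT)).
by exists X.
Qed.

(** Otherwise s could be dropped: replace s by X in every circuit that shows an
    element to be in the cone of T. *)
Lemma minimal_generators T s X : minset generates T -> s \in T -> s != e ->
  X \in K -> negp X = [set s] -> posp X \subset T -> False.
Proof.
move=> /minsetP[gT mT] sT se XK Xs XT.
have sX : s \notin posp X.
  by have := set11 s; rewrite -Xs !inE; case: (X s).
suff gTs : generates (T :\ s).
  by have /setP/(_ s) := mT _ gTs (subD1set _ _); rewrite !inE eqxx sT.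
have XTs : posp X \subset T :\ s.
  apply/subsetP => x xX; rewrite in_setD1 (subsetP XT _ xX) andbT.
  by apply: contraNneq sX => <-.
rewrite /generates in_setD1 eq_sym se (andP gT).1 /=.
apply/forall_inP => f /setDP[fD]; rewrite in_setD1 negb_and negbK => fT.
have [fs|fs] := eqVneq f s.
  by subst f; apply/existsP; exists X; rewrite XK Xs eqxx.
rewrite (negbTE fs) /= in fT.
have [Y YK [Yf YT]] := generatesP gT fD fT.
have [sY|sY] := boolP (s \in posp Y); last first.
  apply/existsP; exists Y; rewrite YK Yf eqxx /=.
  apply/subsetP => x xY; rewrite in_setD1 (subsetP YT _ xY) andbT.
  by apply: contraNneq sY => <-.
have [||||Z ZK [Zf ZT]] := acyclic_substitution (f := f) YK XK _ _ sY.
- move=> E; have := set11 f; rewrite -Yf E negp_svopp => /(subsetP XT).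
  by rewrite (negbTE fT).
- by rewrite Yf.
- by rewrite Xs sub1set !inE eqxx.
- by rewrite Xs inE.
apply/existsP; exists Z; rewrite ZK Zf eqxx /=.
apply: (subset_trans ZT); apply/subsetP => x; rewrite in_setD1 in_setU.
rewrite in_setD1 => /andP[-> /orP[/(subsetP YT)//|/(subsetP XT)//]].
Qed.

(** A minimal generating set T reduces to e.  If it contains another element s,
    let A be the parallel class of s.  Since A cannot be contracted, some
    circuit expresses s by elements outside A; rewriting these in terms of T
    never brings back an element of A, and contradicts the minimality of T. *)
Lemma pair_circuit_of_no_face f : f \in D -> f != e -> pair_circuit e f \in K.
Proof.
move=> fD fe.
have gD : generates D by rewrite /generates eD setDv; apply/forall_inP => x; rewrite inE.
have [T mT TD] := minset_exists gD.
have gT := minsetp mT; have eT := (andP gT).1.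
suff T1 : T \subset [set e].
  have [|X XK [Xf XT]] := generatesP gT fD.
    by apply: contra fe => /(subsetP T1); rewrite inE.
  rewrite -(pair_circuitP (X := X)) //; apply/eqP; rewrite eqEsubset.
  rewrite (subset_trans XT T1) /=; have /set0Pn[x xX] := acyclic_pos XK.
  have := subsetP (subset_trans XT T1) _ xX.
  by rewrite inE => /eqP <-; rewrite sub1set.
apply/subsetP => s sT; rewrite inE; apply/negPn/negP => se.
pose A := s |: [set h | (h != s) && (pair_circuit s h \in K)].
have AP a : a \in A -> a != s -> pair_circuit s a \in K /\ pair_circuit a s \in K.
  rewrite !inE; case: eqP => //= /eqP as_ aK _; split=> //.
  by rewrite -svopp_pair 1?eq_sym // (circuit_opp hK).
have A_pair a b : a \in A -> b \in A -> a != b -> pair_circuit a b \in K.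
  have [-> _|as_ /AP/(_ as_)[_ aK]] := eqVneq a s.
    by move=> bA sb; apply: (AP b bA _).1; rewrite eq_sym.
  have [-> //|bs /AP/(_ bs)[bK _] ab] := eqVneq b s.
  by apply: pair_trans aK bK; rewrite // eq_sym.
have TA h : h \in T -> h \in A -> h = s.
  move=> hT hA; apply/eqP/negPn/negP => hs.
  apply: (minimal_generators mT sT se (AP h hA hs).2).
    exact: negp_pair.
  by rewrite posp_pair sub1set.
have sA : s \in A by rewrite !inE eqxx.
have eA : e \notin A by apply: contra se => /(TA e eT) ->.
have [|Z ZK [ZA ZnA]] := no_face _ eA.
  by apply/set0Pn; exists s; rewrite in_setI sA (subsetP TD).
have /subsetPn[g gZ gA] := ZnA.
(* Two elements of A form a circuit, so Z, which leaves A at g, contains at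
   most one of them. *)
have ZA1 a b : a \in A -> b \in A -> a \in supp Z -> b \in supp Z -> a = b.
  move=> aA bA aZ bZ; apply/eqP/negPn/negP => ab.
  have /setP/(_ g) : supp (pair_circuit a b) = supp Z.
    apply: (circuit_supp_eq hK) => //; first exact: A_pair.
    by rewrite supp_pair; apply/subsetP => x /set2P[] ->.
  rewrite supp_pair in_set2; have -> : g \in supp Z.
    by move: gZ; rewrite !inE => /eqP->.
  by case/orP=> /eqP E; move: gA; rewrite E ?aA ?bA.
have pos_supp x : x \in posp Z -> x \in supp Z by rewrite !inE => /eqP->.
have neg_supp x : x \in negp Z -> x \in supp Z by rewrite !inE => /eqP->.
have /set0Pn[a aZ] := K_acyclic ZK.
have aA := subsetP ZA _ aZ.
have Za : negp Z = [set a].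
  apply/eqP; rewrite eqEsubset sub1set aZ andbT; apply/subsetP => x xZ.
  by rewrite inE (ZA1 x a) ?neg_supp // (subsetP ZA).
have ZpA x : x \in posp Z -> x \notin A.
  move=> xZ; apply/negP => xA; have E : x = a by apply: ZA1; auto.
  by move: aZ xZ; rewrite E !inE => /eqP->.
(* Move the negative element of Z to s inside the parallel class. *)
have [X XK [Xs XA]] : exists2 X, X \in K &
    negp X = [set s] /\ forall x, x \in posp X -> x \notin A.
  have [Eas|as_] := eqVneq a s; first by exists Z => //; rewrite -Eas.
  have asK := (AP a aA as_).2.
  have [|||||W WK [Ws WZ]] := acyclic_substitution (f := s) (s := a) asK ZK.
  - move=> /(congr1 (@negp n)); rewrite negp_pair // negp_svopp => /setP/(_ s).
    by rewrite set11 => /esym/ZpA; rewrite sA.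
  - by rewrite negp_pair.
  - by rewrite posp_pair set11.
  - by rewrite Za sub1set !inE eqxx.
  - by rewrite Za set11.
  exists W => //; split=> // x /(subsetP WZ); rewrite posp_pair !inE.
  by case: eqP => //= _ xZ; have := ZpA x; rewrite !inE; apply.
(* Among these circuits, take one with as few positive elements off T as
   possible; substituting one such element h would give a smaller number. *)
pose P X := [&& X \in K, negp X == [set s] & [disjoint posp X & A]].
have PX : P X.
  by rewrite /P XK Xs eqxx disjoint_subset; apply/subsetP => x /XA.
case: (arg_minnP (fun X => #|posp X :\: T|) PX) => {XK Xs XA PX}.
move=> {}X /and3P[XK /eqP Xs XA] mX.
have [|/subsetPn[h hX hT]] := boolP (posp X \subset T).
  exact: (minimal_generators mT sT se XK Xs).
have hA : h \notin A by rewrite (disjointFr XA hX).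
have hD : h \in D.
  by apply: (subsetP (K_supp XK)); move: hX; rewrite !inE => /eqP->.
have [Y YK [Yh YT]] := generatesP gT hD hT.
have [||||Z' Z'K [Z's Z'T]] := acyclic_substitution (f := s) XK YK _ _ hX.
- (* The substitution fails only for the pair s, h, and then h is in A. *)
  move=> E; case/negP: hA; rewrite !inE; apply/orP; right.
  have -> : pair_circuit s h = Y.
    apply/esym/pair_circuitP => //.
    by rewrite -(svoppK Y) -E posp_svopp.
  rewrite YK andbT; apply: contraNneq hT => ->; exact: sT.
- by rewrite Xs.
- by rewrite Yh sub1set !inE eqxx.
- by rewrite Yh set11.
have sZ' : s \notin posp Z'.
  by have := set11 s; rewrite -Z's !inE; case: (Z' s).
have PZ' : P Z'.
  rewrite /P Z'K Z's eqxx disjoint_subset; apply/subsetP => x xZ'.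
  have := subsetP Z'T _ xZ'; rewrite in_setD1 in_setU => /andP[_].
  case/orP=> [xX|/(subsetP YT) xT]; first exact: negbT (disjointFr XA xX).
  by apply/negP => xA; case/negP: sZ'; rewrite -(TA x xT xA).
have := mX Z' PZ'; rewrite leqNgt => /negP[]; apply: proper_card.
apply/properP; split; last first.
  exists h; first by rewrite in_setD hX hT.
  rewrite in_setD; apply/negP => /andP[_ /(subsetP Z'T)].
  by rewrite in_setD1 eqxx.
apply/subsetP => x; rewrite !in_setD => /andP[xT /(subsetP Z'T)].
rewrite in_setD1 in_setU (negbTE xT) => /andP[_ /orP[//|/(subsetP YT)]].
by rewrite (negbTE xT).
Qed.

End Acyclic.

(** * Orthogonality and positive cocircuits *)

Section Orthogonality.
Variables (n : nat) (M : {set signed n}).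
Hypothesis hM : oriented_matroid M.
Implicit Types (X Y : signed n) (F G : {set 'I_n}).

Lemma orthogonalP X Y : reflect
  (forall g, X g != Zero -> Y g != Zero ->
    (exists2 e, X e != Zero & Y e = X e) /\
    (exists2 e, X e != Zero & Y e = sopp (X e)))
  (Defs.orthogonal X Y).
Proof.
apply: (iffP orP) => [[dXY|/andP[/existsP[a Ha] /existsP[b Hb]]] g Xg Yg|H].
- have := disjointFr dXY (x := g); rewrite !inE Xg => /(_ isT).
  by rewrite (negbTE Yg).
- move: Ha Hb; rewrite !inE.
  move=> /andP[/andP[Xa _] /eqP Ea] /andP[/andP[Xb _] /eqP Eb].
  by split; [exists a | exists b; rewrite // Eb soppK].
have [|] := boolP [disjoint supp X & supp Y]; first by left.
case/pred0Pn=> g /=; rewrite !inE => /andP[Xg Yg]; right.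
have [[a Xa Ya] [b Xb Yb]] := H g Xg Yg; apply/andP; split.
  by apply/existsP; exists a; rewrite !inE Ya Xa eqxx.
by apply/existsP; exists b; rewrite !inE Yb sopp_eq0 Xb soppK eqxx.
Qed.

Lemma cocircuit_orthogonal X Y :
  X \in M -> Y \in cocircuits M -> Defs.orthogonal X Y.
Proof.
move=> XM; rewrite !inE => /andP[/andP[_ /forall_inP/(_ X XM)]] //.
Qed.

(** If X meets the first factor Y, an agreement and a disagreement with X already occur
    on Y and survive in the composition; if not, Y is invisible on X. *)
Lemma covector_orthogonal X v : X \in M -> covector M v -> Defs.orthogonal X v.
Proof.
move=> XM [s sM ->]; elim: s sM => [|Y s IH] sM /=.
  by apply/orthogonalP => g _; rewrite ffunE.
have oY := cocircuit_orthogonal XM (sM Y (mem_head _ _)).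
have {}IH : Defs.orthogonal X (foldr (@scomp n) (szero n) s).
  by apply: IH => Z Zs; apply: sM; rewrite in_cons Zs orbT.
have [dXY|] := boolP [disjoint supp X & supp Y].
  have E e : X e != Zero -> scomp Y (foldr (@scomp n) (szero n) s) e =
      foldr (@scomp n) (szero n) s e.
    move=> Xe; rewrite ffunE; have := disjointFr dXY (x := e).
    by rewrite !inE Xe => /(_ isT)/negbFE ->.
  apply/orthogonalP => g Xg; rewrite E // => vg.
  have [[a Xa va] [b Xb vb]] := orthogonalP _ _ IH g Xg vg.
  by split; [exists a | exists b]; rewrite ?E.
case/pred0Pn=> g /=; rewrite !inE => /andP[Xg Yg].
have [[a Xa Ya] [b Xb Yb]] := orthogonalP _ _ oY g Xg Yg.
apply/orthogonalP => _ _ _; split; [exists a | exists b] => //.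
  by rewrite ffunE Ya (negbTE Xa).
by rewrite ffunE Yb sopp_eq0 (negbTE Xb).
Qed.

(** The contraction of M by G is acyclic and has no loops; by symmetry each circuit
    leaving G then has elements of both signs off G. *)
Definition acyclic_mod G := [forall X in M,
  (supp X \subset G) || [exists h, (h \notin G) && (X h == Neg)]].

Lemma acyclic_modP G : reflect
  (forall X g, X \in M -> g \notin G -> X g != Zero ->
     exists2 h, h \notin G & X h = Neg)
  (acyclic_mod G).
Proof.
apply: (iffP forall_inP) => [H X g XM gG Xg|H X XM].
  case/orP: (H X XM) => [/subsetP/(_ g)|/existsP[h /andP[hG /eqP Xh]]].
    by rewrite inE Xg (negbTE gG) => /(_ isT).
  by exists h.
have [//|/subsetPn[g]] := boolP (supp X \subset G); rewrite inE => Xg gG.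
have [h hG Xh] := H X g XM gG Xg.
by apply/existsP; exists h; rewrite hG Xh.
Qed.

(** A circuit leaving G needs two elements off G to carry both signs. *)
Lemma acyclic_mod_flat G : acyclic_mod G -> flat M G.
Proof.
move=> /acyclic_modP aG C e CM; rewrite inE => Ce CG; apply/negPn/negP => eG.
have only x : x \notin G -> C x != Zero -> x = e.
  move=> xG Cx; apply/eqP/negPn/negP => xe; case/negP: xG.
  by apply: (subsetP CG); rewrite !inE xe.
have [h hG Ch] := aG C e CM eG Ce.
have [||k kG] := aG (svopp C) e _ eG; first exact: (circuit_opp hM).
  by rewrite svoppE sopp_eq0.
rewrite svoppE => Ck.
have kE : k = e by apply: only => //; case: (C k) Ck.
have hE : h = e by apply: only => //; rewrite Ch.
by move: Ck; rewrite kE -hE Ch.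
Qed.

Definition indicator G : signed n := [ffun x => if x \in G then Zero else Pos].

Lemma indicator_orthogonal G X :
  acyclic_mod G -> X \in M -> Defs.orthogonal X (indicator G).
Proof.
move=> /acyclic_modP aG XM; apply/orthogonalP => g Xg; rewrite ffunE.
case: ifPn => // gG _.
have [h hG Xh] := aG X g XM gG Xg.
have [||k kG] := aG (svopp X) g _ gG; first exact: (circuit_opp hM).
  by rewrite svoppE sopp_eq0.
rewrite svoppE => Xk; split; [exists k | exists h].
- by case: (X k) Xk.
- by rewrite ffunE (negbTE kG); case: (X k) Xk.
- by rewrite Xh.
- by rewrite ffunE (negbTE hG) Xh.
Qed.

(** Maximality of G translates into the absence of proper faces of M/G avoiding
    e, so any two elements f, g off G form a circuit of M/G.  A vector
    orthogonal to M that vanishes on G and at g must then vanish at f too,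
    which gives the minimality of the support. *)
Lemma maximal_indicator_cocircuit e G :
  maxset (fun A => (e \notin A) && acyclic_mod A) G ->
  indicator G \in cocircuits M.
Proof.
move=> /maxsetP[/andP[eG aG] mG].
have aGP := acyclic_modP _ aG.
have [K MK] := contraction_exists G hM; have hK := contraction_om MK.
have K_supp X : X \in K -> supp X \subset ~: G.
  move=> /(contraction_lift MK)[Y _ ->]; rewrite supp_del setDE.
  exact: subsetIr.
have K_acyclic X : X \in K -> negp X != set0.
  move=> XK; have [g Xg] := circuit_nonempty hK XK.
  have gG : g \notin G by have := subsetP (K_supp X XK) g; rewrite !inE; apply.
  have [Y YM EY] := contraction_lift MK XK.
  rewrite EY del_notin // in Xg; have [h hG Yh] := aGP Y g YM gG Xg.
  by apply/set0Pn; exists h; rewrite inE EY del_notin // Yh.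
(* The circuit X that obstructs the contraction of G and A is positive off
   them; a circuit of M/G conformal to X through an element off A does it. *)
have no_face (A : {set 'I_n}) : A :&: ~: G != set0 -> e \notin A ->
    exists2 Z, Z \in K & negp Z \subset A /\ ~~ (posp Z \subset A).
  move=> A0 eA.
  have : ~~ acyclic_mod (G :|: A).
    apply: contra A0 => aGA; apply/eqP/setP => x; rewrite !inE.
    have := mG (G :|: A); rewrite in_setU negb_or eG eA aGA subsetUl.
    move=> /(_ isT isT) <-; rewrite in_setU; case: (x \in A) => //=.
    by rewrite orbT.
  rewrite negb_forall_in => /exists_inP[X XM]; rewrite negb_or.
  case/andP=> /subsetPn[g]; rewrite !inE negb_or => Xg /andP[gG gA].
  move=> /existsPn nX.
  have [Z ZK [Zg ZX]] := contraction_cover MK XM gG Xg.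
  have ZA h : Z h = Neg -> h \in A.
    have := nX h; rewrite inE negb_or -andbA => nXh Zh.
    have := ZX h; rewrite Zh ffunE; case: ifPn => // hG [] // Xh.
    by move: nXh; rewrite hG -Xh eqxx andbT => /negPn.
  exists Z => //; split; first by apply/subsetP => h; rewrite inE => /eqP/ZA.
  apply/subsetPn; exists g => //; rewrite inE.
  by case E: (Z g) Zg => // _; move: gA; rewrite (ZA g E).
have pairs f : f \notin G -> f != e -> pair_circuit e f \in K.
  move=> fG fe.
  by apply: (pair_circuit_of_no_face hK K_acyclic K_supp _ no_face); rewrite ?inE.
have pair2 f g : f \notin G -> g \notin G -> f != g -> pair_circuit f g \in K.
  move=> fG gG fg.
  have [E|fe] := eqVneq f e; first by rewrite E pairs // -E eq_sym.
  have feK : pair_circuit f e \in K.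
    by rewrite -svopp_pair 1?eq_sym // (circuit_opp hK) // pairs.
  have [-> //|ge] := eqVneq g e.
  by apply: (pair_trans hK K_acyclic _ _ _ feK (pairs g gG ge)); rewrite // eq_sym.
rewrite inE; apply/andP; split.
  rewrite inE (@neq0_signed _ _ e) ?ffunE ?(negbTE eG) //=.
  by apply/forall_inP => X; apply: indicator_orthogonal.
apply/forall_inP => Y; rewrite inE => /andP[Y0 /forall_inP oY].
apply/negP => /properP[/subsetP YG [h]].
rewrite !inE ffunE; case: ifPn => // hG _ /negbNE/eqP Yh.
have [g Yg] := signed_neq0 Y0.
have gG : g \notin G by have := YG g; rewrite !inE ffunE Yg => /(_ isT); case: ifP.
have gh : g != h by apply: contraNneq Yg => ->; rewrite Yh.
have [X XM EX] := contraction_lift MK (pair2 g h gG hG gh).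
have XE x : x \notin G -> X x = pair_circuit g h x.
  by move=> xG; rewrite EX del_notin.
have only x : X x != Zero -> Y x != Zero -> x = g.
  move=> Xx Yx; have xG : x \notin G.
    by have := YG x; rewrite !inE ffunE Yx => /(_ isT); case: ifP.
  move: Xx; rewrite XE // ffunE; have [//|_] := eqVneq x g.
  by have [E|_] := eqVneq x h; [rewrite E Yh in Yx | rewrite eqxx].
have Xg : X g = Pos by rewrite XE // ffunE eqxx.
have [||[a Xa Ya] [b Xb Yb]] := orthogonalP _ _ (oY X XM) g; rewrite ?Xg //.
have aE : a = g by apply: only; rewrite ?Ya.
have bE : b = g by apply: only; rewrite // Yb sopp_eq0.
by move: Yb; rewrite bE -aE Ya aE Xg.
Qed.

Lemma positive_cocircuit F e : acyclic_mod F -> e \notin F ->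
  exists2 G, indicator G \in cocircuits M & (F \subset G) && (e \notin G).
Proof.
move=> aF eF.
have [|G mG FG] :=
  maxset_exists (P := fun A => (e \notin A) && acyclic_mod A) (C := F).
  by rewrite eF.
exists G; first exact: maximal_indicator_cocircuit mG.
by rewrite FG; have /andP[] := maxsetp mG.
Qed.

Lemma composition_value (s : seq (signed n)) x :
  foldr (@scomp n) (szero n) s x = Zero /\ (forall Y, Y \in s -> Y x = Zero) \/
  exists2 Y, Y \in s & foldr (@scomp n) (szero n) s x = Y x /\ Y x <> Zero.
Proof.
elim: s => [|Y s IH] /=; first by left; rewrite ffunE.
rewrite ffunE; have [Yx|/eqP Yx] := eqVneq (Y x) Zero; last first.
  by right; exists Y; rewrite ?mem_head.
case: IH => [[-> s0]|[Z Zs Zx]]; [left | right].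
  by split=> // Z; rewrite in_cons => /predU1P[->|/s0].
by exists Z; rewrite // in_cons Zs orbT.
Qed.

(** The covector is the composition of all positive cocircuits vanishing on F. *)
Lemma acyclic_mod_positive_flat F : acyclic_mod F -> positive_flat M F.
Proof.
move=> aF; split; first exact: acyclic_mod_flat.
right.
pose s := enum [set Y in cocircuits M | (supp Y \subset ~: F) && (negp Y == set0)].
have sP Y : Y \in s ->
    [/\ Y \in cocircuits M, supp Y \subset ~: F & negp Y = set0].
  by rewrite mem_enum inE => /and3P[? ? /eqP].
exists (foldr (@scomp n) (szero n) s); split.
- by exists s => // Y /sP[].
- move=> x; case: (composition_value s x) => [[-> _]|[Y /sP[_ _ Yn] [-> _]]].
    by right.
  by have /setP/(_ x) := Yn; rewrite !inE; case: (Y x) => // _; [left | right].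
apply/setP => x; rewrite [RHS]inE.
case: (composition_value s x) => [[-> s0]|[Y /sP[_ YF _] [-> /eqP Yx]]]; last first.
  have := subsetP YF x; rewrite !inE Yx => /(_ isT) xF.
  by rewrite (negbTE xF) (negbTE Yx).
rewrite eqxx; apply/negPn/negP => xF.
have [G GM /andP[FG xG]] := positive_cocircuit aF xF.
suff /s0 : indicator G \in s by rewrite ffunE (negbTE xG).
rewrite mem_enum inE GM /=; apply/andP; split.
  apply/subsetP => y; rewrite !inE ffunE; case: ifPn => // yG _.
  by apply/negP => yF; rewrite (subsetP FG _ yF) in yG.
by apply/eqP/setP => y; rewrite !inE ffunE; case: ifP.
Qed.

End Orthogonality.

(** * Initial parts of circuits *)

Section Initial.
Variables (R : realType) (n : nat) (M : {set signed n}).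
Hypothesis hM : oriented_matroid M.
Variable w : 'rV[R]_n.
Implicit Types (X Y Z C : signed n) (F : {set 'I_n}).

Definition below (r : R) : {set 'I_n} := [set x | w 0 x < r].

Lemma initialE C x : C x != Zero -> (forall y, C y != Zero -> w 0 y <= w 0 x) ->
  initial w C = del (below (w 0 x)) C.
Proof.
move=> Cx mx; apply/ffunP => y; rewrite !ffunE inE ltNge.
have [Cy|Cy] := eqVneq (C y) Zero; first by rewrite Cy !if_same.
suff -> : [forall f in supp C, w 0 f <= w 0 y] = (w 0 x <= w 0 y).
  by case: (w 0 x <= w 0 y).
apply/forall_inP/idP => [|xy f]; first by apply; rewrite inE.
by rewrite inE => /mx /le_trans; apply.
Qed.

Lemma initial_at C x : initial w C x != Zero ->
  [/\ C x != Zero, forall y, C y != Zero -> w 0 y <= w 0 x &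
      initial w C = del (below (w 0 x)) C].
Proof.
rewrite ffunE; case: ifP => // /forall_inP mx Cx.
have {}mx y : C y != Zero -> w 0 y <= w 0 x by move=> Cy; apply: mx; rewrite inE.
by split=> //; apply: initialE.
Qed.

Lemma initial_neq0 C : C \in M -> exists x, initial w C x != Zero.
Proof.
move=> /(circuit_nonempty hM)[x0 Cx0].
case: (Order.TotalTheory.arg_maxP (P := fun x => C x != Zero) (w 0) Cx0).
move=> x Cx mx; exists x; rewrite (initialE Cx mx) del_notin //.
by rewrite inE ltxx.
Qed.

Lemma initial_svopp C : initial w (svopp C) = svopp (initial w C).
Proof.
apply/ffunP => x; rewrite !ffunE supp_svopp; case: ifP => //.
Qed.

(** A positive initial part of C contains a circuit of the contraction by the
    elements below it, and this circuit is a positive circuit of the initial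
    matroid. *)
Lemma acyclic_initial_neg C : acyclic (initial_matroid w M) -> C \in M ->
  exists e, e \in negp (initial w C).
Proof.
move=> aM CM; apply/set0Pn/negP => /eqP noneg; apply: aM.
have [x ICx] := initial_neq0 CM.
have [Cx mx EC] := initial_at ICx.
pose F := below (w 0 x).
have xF : x \notin F by rewrite inE ltxx.
have [K MK] := contraction_exists F hM; have hK := contraction_om MK.
have [Z ZK [Zx ZC]] := contraction_cover MK CM xF Cx.
rewrite -EC in ZC.
have Zpos e : e \in supp Z -> Z e = Pos.
  rewrite inE; case: (ZC e) => [->//|E]; have /setP/(_ e) := noneg.
  by rewrite !inE -E; case: (Z e).
have level e : Z e != Zero -> w 0 e = w 0 x.
  move=> Ze; have : initial w C e != Zero by case: (ZC e) Ze => ->.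
  rewrite EC ffunE inE; case: ltP => // xe Ce.
  by apply/eqP; rewrite eq_le xe mx.
exists Z => //; rewrite inE; apply/andP; split.
  have [X XM EX] := contraction_lift MK ZK; apply/imsetP; exists X => //.
  rewrite EX (initialE (x := x)) //.
    by move: Zx; rewrite EX del_notin.
  move=> y Xy; rewrite leNgt; apply/negP => xy.
  suff yx : w 0 y = w 0 x by rewrite yx ltxx in xy.
  by apply: level; rewrite EX del_notin // inE -leNgt ltW.
apply/forallP => U; apply/implyP => /imsetP[Y YM ->]; apply/negP => pYZ.
have [y IYy] := initial_neq0 YM; have [Yy _ EY] := initial_at IYy.
have yx : w 0 y = w 0 x.
  by apply: level; have := subsetP (proper_sub pYZ) y; rewrite !inE; apply.
rewrite yx in EY.
have yF : y \notin F by rewrite inE yx ltxx.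
have [W WK [_ WY]] := contraction_cover MK YM yF Yy.
have pWZ : supp W \proper supp Z.
  by apply: sub_proper_trans pYZ; rewrite EY conformal_supp.
by move: (pWZ); rewrite (circuit_supp_eq hK WK ZK (proper_sub pWZ)) properxx.
Qed.

Lemma acyclic_initial C : acyclic (initial_matroid w M) -> C \in M ->
  (exists e, e \in posp (initial w C)) /\ (exists e, e \in negp (initial w C)).
Proof.
move=> aM CM; split; last exact: acyclic_initial_neg.
rewrite -negp_svopp -initial_svopp; apply: acyclic_initial_neg => //.
exact: (circuit_opp hM).
Qed.

Lemma initial_neg_acyclic :
  (forall C, C \in M -> exists e, e \in negp (initial w C)) ->
  acyclic (initial_matroid w M).
Proof.
move=> H [D]; rewrite inE => /andP[/imsetP[C CM ->] _] Dpos.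
have [e eC] := H C CM; have := Dpos e; move: eC.
by rewrite !inE => /eqP-> /(_ isT).
Qed.

Lemma initial_neg_acyclic_mod F :
  (forall C, C \in M -> exists e, e \in negp (initial w C)) ->
  (forall x y, x \in F -> y \notin F -> w 0 x < w 0 y) ->
  acyclic_mod M F.
Proof.
move=> H lowF; apply/acyclic_modP => X g XM gF Xg.
have [e] := H X XM; rewrite inE => /eqP IXe.
have [|_ mx _] := initial_at (C := X) (x := e); rewrite ?IXe //.
exists e; last by move: IXe; rewrite ffunE; case: ifP.
by apply/negP => eF; have := lowF e g eF gF; rewrite ltNge mx.
Qed.

(** The positive covector vanishing below the top weight of C meets C exactly in
    its initial part, so orthogonality is a statement on that part. *)
Lemma positive_flat_initial C x : C \in M -> initial w C x != Zero ->
  positive_flat M (below (w 0 x)) ->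
  (exists e, e \in posp (initial w C)) /\ (exists e, e \in negp (initial w C)).
Proof.
move=> CM ICx [_ [FT|[v [vM vpos Fv]]]].
  by have := in_setT x; rewrite -FT inE ltxx.
have [Cx _ EC] := initial_at ICx.
have v0 e : (v e == Zero) = (w 0 e < w 0 x).
  by have /setP/(_ e) := Fv; rewrite !inE.
have top e : v e != Zero -> initial w C e = C e.
  by rewrite v0 => xe; rewrite EC del_notin // inE.
have [||[a Ca va] [b Cb vb]] :=
  orthogonalP _ _ (covector_orthogonal CM vM) x => //; first by rewrite v0 ltxx.
split; [exists a | exists b]; rewrite inE top ?va ?vb ?sopp_eq0 //.
  by case: (vpos a) => E; rewrite -va E // in Ca *.
by case: (vpos b) vb => -> /esym; case: (C b) Cb.
Qed.

End Initial.

(** * The flag of a weight *)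

Section Flag.
Variables (R : realType) (n : nat) (w : 'rV[R]_n) (Fs : seq {set 'I_n}).
Hypothesis hFs : is_flag_of w Fs.

Local Notation Fn := (nth set0 Fs).

Definition level_of (x : 'I_n) := find (fun F : {set 'I_n} => x \in F) Fs.

Lemma in_some_member x : has (fun F : {set 'I_n} => x \in F) Fs.
Proof.
case: hFs; case: Fs => // F s _ /= lastT _ _ _.
by apply/(@hasP _ _ (F :: s)); exists [set: 'I_n]; rewrite ?in_setT // -lastT mem_last.
Qed.

Lemma member_mono i j : (i <= j)%N -> (j < size Fs)%N -> Fn i \subset Fn j.
Proof.
case: hFs => _ _ inc _ _.
elim: j => [|j IH]; first by rewrite leqn0 => /eqP->.
rewrite leq_eqVlt => /predU1P[-> //|ij] jF.
by apply: subset_trans (IH ij (ltnW jF)) (proper_sub (inc j jF)).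
Qed.

Lemma in_member x i : (i < size Fs)%N -> (x \in Fn i) = (level_of x <= i)%N.
Proof.
move=> iF; apply/idP/idP => [xi|xi]; last first.
  by apply: (subsetP (member_mono xi iF)); exact: (nth_find set0 (in_some_member x)).
by rewrite leqNgt; apply/negP => /(before_find set0) /=; rewrite xi.
Qed.

Lemma level_lt_size x : (level_of x < size Fs)%N.
Proof. by rewrite -has_find in_some_member. Qed.

Lemma level_gt0 x : (0 < level_of x)%N.
Proof.
rewrite ltnNge -in_member; last by apply: leq_ltn_trans (level_lt_size x).
by case: hFs; case: Fs => //= F s [->]; rewrite inE.
Qed.

Lemma level_layer x i : level_of x = i.+1 -> x \in Fn i.+1 :\: Fn i.
Proof.
move=> xi; have iF : (i.+1 < size Fs)%N by rewrite -xi level_lt_size.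
by rewrite in_setD !in_member ?(ltnW iF) // xi ltnn leqnn.
Qed.

Lemma level_eq_weight x y : level_of x = level_of y -> w 0 x = w 0 y.
Proof.
case E: (level_of x) (level_gt0 x) => [//|i] _ /esym Ey.
case: hFs => _ _ _ cst _; apply: (cst i); rewrite ?level_layer // -E.
exact: level_lt_size.
Qed.

Lemma level_nonempty i : (i.+1 < size Fs)%N -> exists x, level_of x = i.+1.
Proof.
move=> iF; case: hFs => _ _ inc _ _.
have /properP[_ [x xi]] := inc i iF; rewrite in_member ?(ltnW iF) // -ltnNge => ix.
by exists x; apply/eqP; rewrite eqn_leq ix -in_member // xi.
Qed.

(** The flag only compares consecutive layers; layers are nonempty, which allows
    going from one to a later one in steps. *)
Lemma level_lt_weight x y : (level_of x < level_of y)%N -> w 0 x < w 0 y.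
Proof.
case Ex: (level_of x) (level_gt0 x) => [//|i] _.
move Ej: (level_of y) => j; elim: j y Ej => [//|j IH] y Ey.
rewrite ltnS leq_eqVlt => ij; have jF : (j.+1 < size Fs)%N by rewrite -Ey level_lt_size.
case: j => [|j] in IH Ey ij jF *; first by case/orP: ij.
have [z Ez] := level_nonempty (ltnW jF).
have zy : w 0 z < w 0 y.
  by case: hFs => _ _ _ _ str; apply: (str j); rewrite ?level_layer.
case/orP: ij => [/eqP[ij]|ij]; first by rewrite (level_eq_weight (y := z)) // Ex ij Ez.
exact: lt_trans (IH z Ez ij) zy.
Qed.

Lemma flag_lower F x y : F \in Fs -> x \in F -> y \notin F -> w 0 x < w 0 y.
Proof.
move=> /(nthP set0)[i iF <-]; rewrite !in_member // -ltnNge => xi iy.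
by apply: level_lt_weight; apply: leq_ltn_trans iy.
Qed.

Lemma below_in_flag x : below w (w 0 x) \in Fs.
Proof.
have pF : ((level_of x).-1 < size Fs)%N.
  by apply: leq_ltn_trans (leq_pred _) (level_lt_size x).
suff -> : below w (w 0 x) = Fn (level_of x).-1 by apply: mem_nth.
apply/setP => y; rewrite [LHS]inE in_member // -[in RHS]ltnS prednK ?level_gt0 //.
case: (ltngtP (level_of y) (level_of x)) =>
  [/level_lt_weight-> //|/level_lt_weight/ltW|/level_eq_weight->].
  by rewrite ltNge => ->.
by rewrite ltxx.
Qed.

End Flag.

(** * The equivalence *)

Theorem theorem3p4 (R : realType) (n : nat) (M : {set signed n})
    (hM : oriented_matroid M) (w : 'rV[R]_n)
    (Fs : seq {set 'I_n}) (hFs : is_flag_of w Fs) :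
  [<-> acyclic (initial_matroid w M);
       forall C, C \in M ->
         (exists e, e \in posp (initial w C)) /\
         (exists e, e \in negp (initial w C));
       forall F, F \in Fs -> positive_flat M F].
Proof.
tfae.
- by move=> aM C; apply: acyclic_initial.
- move=> H F FFs; apply: (acyclic_mod_positive_flat hM).
  apply: (initial_neg_acyclic_mod (w := w)).
    by move=> C /H[].
  by move=> x y; apply: flag_lower FFs.
- move=> H; apply: initial_neg_acyclic => C CM.
  have [x ICx] := initial_neq0 hM w CM.
  apply: (positive_flat_initial CM ICx _).2.
  exact/H/below_in_flag.
Qed.
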